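(* Let $d\in\mathbb{N}$ and let $X$ be a centred Gaussian random vector in $\mathbb{R}^d$ with invertible covariance matrix $V\in\mathbb{R}^{d\times d}$. Then for all $\vec n=(n_1,\dots,n_d),\ \vec m=(m_1,\dots,m_d)\in\mathbb{Z}_{\ge 0}^d$, $$\mathbb{E}_{X\sim\mathcal{N}(\vec 0,V)}\big[H_{\vec n}(X;V)\,\widetilde H_{\vec m}(X;V)\big]=\begin{cases}\prod_{j=1}^d n_j! & \text{if }\vec n=\vec m,\\ 0 & \text{if }\vec n\ne\vec m.\end{cases}$$
   Context: For $\vec x\in\mathbb{R}^d$ and a $d\times d$ invertible covariance matrix $V$, the multivariable Hermite polynomials and their duals are defined, with $\imath=\sqrt{-1}$, by $$\widetilde H_{m_1,\dots,m_d}(x_1,\dots,x_d;V)=\mathbb{E}_{\vec Z\sim\mathcal{N}(0,V)}\Big[\prod_{b=1}^d (x_b+\imath Z_b)^{m_b}\Big],$$ $$H_{n_1,\dots,n_d}(x_1,\dots,x_d;V)=\mathbb{E}_{\vec Z\sim\mathcal{N}(0,V^{-1})}\Big[\prod_{a=1}^d\big((V^{-1}\vec x)_a+\imath Z_a\big)^{n_a}\Big].$$ *)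

(* Defs.v *)
From HB Require Import structures.
From mathcomp Require Import all_boot all_order all_algebra.
From mathcomp Require Import all_classical all_reals all_analysis measurable_realfun.
From mathcomp Require Import complex.

Set Implicit Arguments.
Unset Strict Implicit.
Unset Printing Implicit Defensive.

Import Order.TTheory GRing.Theory Num.Theory.
Import numFieldNormedType.Exports.

Local Open Scope classical_set_scope.
Local Open Scope ring_scope.

(* R^d with its Borel (product) sigma-algebra *)
Notation Rvec R d := (d.-tuple (measurableTypeR R)).

Definition col_of (R : realType) (d : nat) (x : Rvec R d) : 'cV[R]_d :=
  \col_i tnth x i.

Definition tuple_of_col (R : realType) (d : nat) (v : 'cV[R]_d) : Rvec R d :=
  [tuple v i 0 | i < d].

Section StandardNormal.
Context {R : realType}.

Definition cons_vec (d : nat) (p : measurableTypeR R * Rvec R d) :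
  Rvec R d.+1 := [tuple of p.1 :: p.2].

Lemma measurable_cons_vec d : measurable_fun setT (@cons_vec d).
Proof. exact: (measurable_cons measurable_fst measurable_snd). Qed.

HB.instance Definition _ d :=
  isMeasurableFun.Build _ _ _ _ (@cons_vec d) (@measurable_cons_vec d).

Fixpoint std_normal (d : nat) : probability (Rvec R d) R :=
  match d with
  | 0 => dirac ([tuple] : Rvec R 0)
  | d'.+1 => distribution (normal_prob (0 : R) 1 \x std_normal d')%E (@cons_vec d')
  end.

End StandardNormal.

Section Normal.
Context {R : realType} {d : nat}.

Definition lin_vec (A : 'M[R]_d) (z : Rvec R d) : Rvec R d :=
  tuple_of_col (A *m col_of z).

Lemma measurable_lin_vec A : measurable_fun setT (lin_vec A).
Proof.
apply/measurable_fun_tnthP => i.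
rewrite (_ : _ \o _ = fun z : Rvec R d => \sum_j A i j * tnth z j).
  apply: measurable_sum => j; apply: measurable_funM => //.
  exact: measurable_tnth.
apply/funext => z /=; rewrite tnth_mktuple mxE.
by apply: eq_bigr => j _; rewrite mxE.
Qed.

HB.instance Definition _ A :=
  isMeasurableFun.Build _ _ _ _ (lin_vec A) (measurable_lin_vec A).

(* Some A with A A^T = V; it exists as soon as V is symmetric positive
   semidefinite, and the law of A G, for G standard normal, does not depend on
   which one is chosen. The default value 0 is irrelevant for such V. *)
Definition mx_root (V : 'M[R]_d) : 'M[R]_d :=
  xget 0 [set A | A *m A^T = V].

(* N(0, V), as the law of A G for G standard normal in R^d and A A^T = V *)
Definition mvnormal (V : 'M[R]_d) : probability (Rvec R d) R :=
  distribution (std_normal d) (lin_vec (mx_root V)).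

End Normal.

Section GaussianVector.
Context {disp : measure_display} {T : measurableType disp} {R : realType}.

(* [normal_prob m s] is the uniform law on [0, 1] when s = 0, hence the
   separate treatment of degenerate (constant) Gaussian variables. *)
Definition gaussian_var (P : probability T R) (Y : T -> R) : Prop :=
  exists m s : R, forall B : set (measurableTypeR R), measurable B ->
    P (Y @^-1` B) = (if s == 0 then \d_m B else normal_prob m s B).

Definition gaussian_vec (P : probability T R) (d : nat)
    (X : T -> Rvec R d) : Prop :=
  forall t : 'I_d -> R, gaussian_var P (fun w => \sum_i t i * tnth (X w) i).

Definition centred_gaussian_vec (P : probability T R) (d : nat)
    (V : 'M[R]_d) (X : T -> Rvec R d) : Prop :=
  [/\ gaussian_vec P X,
      forall i, ('E_P[fun w => tnth (X w) i] = 0)%E &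
      forall i j,
        covariance P (fun w => tnth (X w) i) (fun w => tnth (X w) j)
          = (V i j)%:E].

Definition cexpectation (P : probability T R) (f : T -> R[i]) : R[i] :=
  Complex (fine 'E_P[fun w => complex.Re (f w)]%E)
          (fine 'E_P[fun w => complex.Im (f w)]%E).

End GaussianVector.

Section Hermite.
Context {R : realType} {d : nat}.

Definition hermite_tilde (m : {ffun 'I_d -> nat}) (x : 'cV[R]_d)
    (V : 'M[R]_d) : R[i] :=
  cexpectation (mvnormal V)
    (fun z => \prod_b Complex (x b 0) (tnth z b) ^+ m b).

Definition hermite (n : {ffun 'I_d -> nat}) (x : 'cV[R]_d)
    (V : 'M[R]_d) : R[i] :=
  cexpectation (mvnormal (invmx V))
    (fun z => \prod_a Complex ((invmx V *m x) a 0) (tnth z a) ^+ n a).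

End Hermite.

(* Main.v *)
Require Import Defs.
From HB Require Import structures.
From mathcomp Require Import all_boot all_order all_algebra.
From mathcomp Require Import all_classical all_reals all_analysis.
From mathcomp Require Import measurable_realfun complex ring lra.
From mathcomp Require Import -(notations) mpoly.

(** Why the theorem holds. Let X, Z, Z' be independent, with X and Z' of law
    N(0, V) and Z of law N(0, V^-1), and put

      xi_a = (V^-1 X)_a + i Z_a,      eta_b = X_b + i Z'_b.

    Integrating out Z and Z' first, the expectation to compute is
    E[prod_a xi_a^(n_a) prod_b eta_b^(m_b)]. These are complex linear forms in a
    Gaussian vector, and because of the factors i their covariances
    (without conjugation) are

      E[xi_a xi_c] = V^-1 - V^-1 = 0,   E[eta_b eta_c] = V - V = 0,
      E[xi_a eta_b] = (V^-1 V)_ab = delta_ab.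

    Gaussian integration by parts, E[zeta F] = E[D_zeta F] for the derivation
    D_zeta which sends a linear form to its covariance with zeta, then removes
    the factors xi_a one by one: D_(xi_a) kills every xi_c and every eta_b with
    b <> a, and sends eta_a^k to k eta_a^(k-1). What is left is n! when n = m,
    and otherwise an expectation that vanishes because a factor of one kind
    remains with nothing to pair with (gauss_biorthogonal).

    Every integrand is a polynomial, so only moments matter. All computations
    are made in a ring of multivariate polynomials, where the expectation of
    standard normal variables is the linear functional gauss, defined by its
    values on monomials, and where integration by parts is an identity on
    monomials (gauss_mulX). It remains to relate the integrals to gauss.

    - The moments of the one-dimensional normal law satisfy
      mu_(k+1) = k s^2 mu_(k-1), by integrating the derivative of
      (x - m)^k exp(-(x - m)^2 / 2 s^2) over the line (normal_prob_moment).
      Fubini gives the moments of the standard normal vector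
      (std_normal_moment).

    - X is only known through the laws of its linear forms t.X. These give
      E[(t.X)^k], and the powers of linear forms span all polynomials
      (polarization), so X has the same mixed moments as B G, with G standard
      normal and B B^T = V (gaussian_moment). Such a B exists as V is a
      covariance matrix (psd_root).

    - Expectations of complex polynomials in three vectors, taken successively,
      depend on the mixed moments only (cexpectation3). This replaces
      (X, Z, Z') by linear images of three standard normal vectors. *)

Set Implicit Arguments.
Unset Strict Implicit.
Unset Printing Implicit Defensive.

Import Order.TTheory GRing.Theory Num.Theory.
Import numFieldNormedType.Exports.

Local Open Scope ring_scope.

(** The k-th moment of N(0, 1), that is (k - 1)!! for even k and 0 for odd k. *)
Fixpoint gmom (k : nat) : nat :=
  match k with
  | 0 => 1
  | 1 => 0
  | k'.+2 => k'.+1 * gmom k'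
  end.

Lemma gmomS k : gmom k.+1 = (k * gmom k.-1)%N. Proof. by case: k. Qed.

(** The odd moments vanish, so the moments of N(0, s^2) are functions of s^2;
    the sign of the square root s does not matter. *)
Lemma gmom_sqr (A : comNzRingType) (s : A) k :
  s ^+ k * (gmom k)%:R = (s ^+ 2) ^+ k./2 * (gmom k)%:R.
Proof.
have [n] := ubnP k; elim: n k => // n IH [|[|k]] kn //=; first by rewrite !mulr0.
have /IH h : (k < n)%N by exact: (ltn_trans (ltnSn k) kn).
move: (gmom k) h => G h; rewrite natrM mulrCA exprSr exprSr.
have -> : s ^+ k * s * s * G%:R = s ^+ 2 * (s ^+ k * G%:R) by ring.
by rewrite h [(s ^+ 2) ^+ _.+1]exprS; ring.
Qed.

(** * Moments of the one-dimensional normal law *)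

Section NormalMoments.
Local Open Scope classical_set_scope.
Variable R : realType.
Implicit Types (m s x : R) (k : nat).
Local Notation mu := (@lebesgue_measure R).

(** A power is absorbed by half of the exponent: with y = (x - m)^2 / (4 s^2) the
    left-hand side is |x - m|^k e^(-2 y), and y^k <= k! e^y. The right-hand side
    is a Gaussian of variance 2 s^2, hence integrable. *)
Lemma pow_normal_fun_le m s k x : s != 0 ->
  `|x - m| ^+ k * normal_fun m s x <=
  (1 + (4 * s ^+ 2) ^+ k * k`!%:R) * normal_fun m (Num.sqrt 2 * s) x.
Proof.
move=> s0; have s2 : 0 < s ^+ 2 by rewrite exprn_even_gt0.
rewrite /normal_fun.
set y : R := (x - m) ^+ 2 / (4 * s ^+ 2).
have y0 : 0 <= y by rewrite /y divr_ge0 ?sqr_ge0// ltW// mulr_gt0.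
have -> : - (x - m) ^+ 2 / (s ^+ 2 *+ 2) = - y + - y.
  rewrite /y; field; lra.
have -> : - (x - m) ^+ 2 / ((Num.sqrt 2 * s) ^+ 2 *+ 2) = - y.
  rewrite exprMn sqr_sqrtr// /y; field; lra.
rewrite expRD mulrA ler_pM2r ?expR_gt0//.
rewrite expRN ler_pdivrMr ?expR_gt0//.
(* odd powers are avoided: t <= 1 + t^2 *)
have h1 : `|x - m| ^+ k <= 1 + (`|x - m| ^+ k) ^+ 2.
  by have := sqr_ge0 (`|x - m| ^+ k - 1); nra.
apply: (le_trans h1).
have -> : (`|x - m| ^+ k) ^+ 2 = (4 * s ^+ 2) ^+ k * y ^+ k.
  rewrite -exprM mulnC exprM real_normK ?num_real// -exprMn /y.
  by congr (_ ^+ _); field; lra.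
have yk : y ^+ k <= k`!%:R * expR y.
  have f0 : (0 : R) < k`!%:R by rewrite ltr0n fact_gt0.
  case: k f0 {h1} => [|k] f0.
    by rewrite fact0 mul1r expr0 (le_trans _ (expR_ge1Dx y))// lerDl.
  rewrite -ler_pdivrMl// (mulrC _^-1); apply: (le_trans _ (expR_ge1Dxn k y0)).
  by rewrite lerDr.
rewrite [leRHS]mulrDl mul1r; apply: lerD.
  by rewrite (le_trans _ (expR_ge1Dx y))// lerDl.
by rewrite -mulrA ler_wpM2l// exprn_ge0// ltW// mulr_gt0.
Qed.

Lemma integrable_normal_fun m s : s != 0 ->
  mu.-integrable setT (EFin \o normal_fun m s).
Proof.
move=> s0; have H := integrable_normal_pdf m s.
have -> : EFin \o normal_fun m s =
    (fun x => ((normal_peak s)^-1)%:E * (normal_pdf m s x)%:E)%E.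
  apply/funext => x.
  rewrite /= -EFinM /normal_pdf (negbTE s0) mulrA mulVf ?mul1r//.
  by rewrite gt_eqF// normal_peak_gt0.
exact: integrableZl.
Qed.

Lemma integrable_pow_normal_fun m s k : s != 0 ->
  mu.-integrable setT (fun x => ((x - m) ^+ k * normal_fun m s x)%:E).
Proof.
move=> s0.
have s20 : Num.sqrt 2 * s != 0 by rewrite mulf_neq0// gt_eqF// sqrtr_gt0.
have H := integrableZl measurableT (1 + (4 * s ^+ 2) ^+ k * k`!%:R)
  (integrable_normal_fun m s20).
apply: (le_integrable _ _ _ H) => //.
- apply/measurable_EFinP/measurable_funM => //; last exact: measurable_normal_fun.
  by apply: measurable_funX; exact: measurable_funB.
- move=> x _.
  rewrite /= lee_fin normrM normrX (ger0_norm (normal_fun_ge0 _ _ _)).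
  by rewrite (le_trans (pow_normal_fun_le _ _ _ s0))// ler_norm.
Qed.

Lemma is_derive_pow_normal_fun m s k x : s != 0 ->
  is_derive x (1 : R) (fun x => (x - m) ^+ k * normal_fun m s x)
    (k%:R * ((x - m) ^+ k.-1 * normal_fun m s x) -
     (x - m) ^+ k.+1 * normal_fun m s x / s ^+ 2).
Proof.
move=> s0; have s2 : s ^+ 2 != 0 by rewrite expf_neq0.
pose p : {poly R} := 'X - m%:P.
have dg := is_derive_poly (- (s ^+ 2 *+ 2)^-1 *: p ^+ 2) x.
have df := is_derive_poly (p ^+ k) x.
have de := is_derive1_comp (is_derive_expR _) dg.
have -> : (fun x => (x - m) ^+ k * normal_fun m s x) =
    (horner (p ^+ k)) * (expR \o horner (- (s ^+ 2 *+ 2)^-1 *: p ^+ 2)).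
  apply/funext => y; rewrite fctE /= /normal_fun /p.
  rewrite hornerZ !horner_exp hornerXsubC; congr (_ * expR _).
  by field; rewrite ?s0.
have H := is_deriveM df de; refine (is_derive_eq H _).
rewrite -![_ *: _]/(_ * _) /= /normal_fun derivZ !deriv_exp /=.
rewrite !(hornerZ, hornerMn, hornerM, horner_exp) /p derivB derivX derivC.
rewrite hornerXsubC subr0 hornerC expr1.
set e1 := expR _; set e2 := expR _.
have -> : e1 = e2 by congr expR; field.
rewrite -[e2 *: _]/(e2 * _) -(mulr_natr _ k) (exprS _ k).
move: (x - m) (_ ^+ k) (_ ^+ k.-1) (k%:R) => u w w' c {e1}.
by move: e2 s2 => e; move: (s ^+ 2) => v v0; field; rewrite v0.
Qed.

Lemma continuous_pow_normal_fun m s k : s != 0 ->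
  continuous (fun x => (x - m) ^+ k * normal_fun m s x).
Proof.
move=> s0 x; apply: differentiable_continuous; apply/derivable1_diffP.
exact: (@ex_derive _ _ _ _ _ _ _ (is_derive_pow_normal_fun m k x s0)).
Qed.

(** The integrals over [-n, n] tend to the integral over the line by dominated
    convergence, and to 0 by the fundamental theorem of calculus. *)
Lemma integral_derivative_eq0 (F f : R -> R) :
  (forall x, is_derive x (1 : R) F (f x)) -> continuous f ->
  mu.-integrable setT (EFin \o f) ->
  F n%:R @[n --> \oo] --> (0 : R) -> F (- n%:R) @[n --> \oo] --> (0 : R) ->
  (\int[mu]_x (f x)%:E = 0)%E.
Proof.
move=> dF cf intf Fp Fn.
have cF : continuous F.
  by move=> x; apply/differentiable_continuous/derivable1_diffP/ex_derive.
(* n.+1 rather than n: the fundamental theorem asks for a nontrivial segment *)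
pose I (n : nat) : set R := `[- n.+1%:R, n.+1%:R]%classic.
have mI n : measurable (I n) by exact: measurable_itv.
have h n : (\int[mu]_x ((EFin \o f) \_ (I n)) x =
    (F n.+1%:R - F (- n.+1%:R))%:E)%E.
  rewrite -integral_mkcond (@continuous_FTC2 _ f F).
  - by rewrite EFinB.
  - by rewrite ltrNl (lt_le_trans (y := 0)) ?oppr_lt0 ?ltr0n.
  - exact: continuous_subspaceT.
  - split.
    + by move=> x _; exact: ex_derive.
    + apply: cvg_at_right_filter; exact: cF.
    + apply: cvg_at_left_filter; exact: cF.
  - by move=> x _; rewrite derive1E; exact: derive_val.
have L1 : ((\int[mu]_x ((EFin \o f) \_ (I n)) x)%E @[n --> \oo] -->
    (\int[mu]_x (f x)%:E)%E)%classic.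
  apply: (@dominated_cvg _ _ _ mu setT measurableT _ (EFin \o f)
    (abse \o (EFin \o f))) => //.
  - move=> n; apply/(measurable_restrict _ _ _) => //.
      exact: mI.
    by apply: measurable_funTS; exact: measurable_int intf.
  - move=> x _; apply: cvg_near_cst; near=> n.
    rewrite patchE ifT// inE /I/= in_itv/= -ler_norml.
    rewrite (@le_trans _ _ n%:R)//; last by rewrite ler_nat.
    near: n; exact: nbhs_infty_ger.
  - exact: integrable_abse.
  - move=> n x _; rewrite patchE; case: ifPn => //= _.
    by rewrite normr0 lee_fin.
have L2 : ((\int[mu]_x ((EFin \o f) \_ (I n)) x)%E @[n --> \oo] --> 0%E)%classic.
  rewrite (funext h); apply/cvg_EFin; first by near=> n.
  rewrite -[X in _ --> X](subrr 0).
  apply: cvgB; first by rewrite -(cvg_shiftS (fun n => F n%:R)) in Fp.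
  by rewrite -(cvg_shiftS (fun n => F (- n%:R))) in Fn.
exact: (cvg_unique _ L1 L2).
Unshelve. all: by end_near.
Qed.

(** By pow_normal_fun_le at exponent k + 1 the function is O(1 / |x - m|). *)
Lemma cvg_pow_normal_fun m s k (u : nat -> R) : s != 0 ->
  `|u n| @[n --> \oo] --> +oo ->
  (u n - m) ^+ k * normal_fun m s (u n) @[n --> \oo] --> (0 : R).
Proof.
move=> s0 uy.
pose C : R := 1 + (4 * s ^+ 2) ^+ k.+1 * k.+1`!%:R.
have C0 : 0 < C.
  by rewrite /C ltr_wpDr// mulr_ge0// exprn_ge0// mulr_ge0// sqr_ge0.
have bd x : `|x - m| * `|(x - m) ^+ k * normal_fun m s x| <= C.
  rewrite normrM normrX (ger0_norm (normal_fun_ge0 _ _ _)) mulrA -exprS.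
  apply: (le_trans (pow_normal_fun_le m k.+1 x s0)).
  rewrite -[leRHS]mulr1 ler_pM2l// /normal_fun expR_le1 mulNr oppr_le0.
  by rewrite divr_ge0 ?sqr_ge0// mulrn_wge0// sqr_ge0.
apply/cvgr0Pnorm_lt => e e0; near=> n.
have hn : `|m| + C / e < `|u n|.
  by near: n; apply: (cvgryPgt _).1.
have hm : C / e < `|u n - m|.
  by have := lerB_dist (u n) m; lra.
rewrite ltNge; apply/negP => he.
have := bd (u n); rewrite leNgt => /negP; apply.
rewrite -(divfK (lt0r_neq0 e0) C).
apply: lt_le_trans (ler_wpM2l (normr_ge0 _) he).
by rewrite ltr_pM2r.
Unshelve. all: by end_near.
Qed.

(** Integration by parts: the derivative of (x - m)^k normal_fun has integral
    0. For k = 0 this says that the mean is m. *)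
Lemma integral_pow_normal_funS m s k : s != 0 ->
  (\int[mu]_x ((x - m) ^+ k.+1 * normal_fun m s x)%:E =
   (k%:R * s ^+ 2)%:E * \int[mu]_x ((x - m) ^+ k.-1 * normal_fun m s x)%:E)%E.
Proof.
move=> s0; have s2 : s ^+ 2 != 0 by rewrite expf_neq0.
have i1 := integrable_pow_normal_fun m k.-1 s0.
have i2 := integrable_pow_normal_fun m k.+1 s0.
pose f x : R := k%:R * ((x - m) ^+ k.-1 * normal_fun m s x) -
     (x - m) ^+ k.+1 * normal_fun m s x / s ^+ 2.
have fE : EFin \o f =
    (fun x => (k%:R)%:E * ((x - m) ^+ k.-1 * normal_fun m s x)%:E
      - (s ^+ 2)^-1%:E * ((x - m) ^+ k.+1 * normal_fun m s x)%:E)%E.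
  apply/funext => x; rewrite /f /= -!EFinM -EFinB.
  by congr (_ - _)%:E; rewrite mulrC.
have : (\int[mu]_x (f x)%:E = 0)%E.
  apply: (@integral_derivative_eq0 (fun x => (x - m) ^+ k * normal_fun m s x)).
  - by move=> x; exact: is_derive_pow_normal_fun.
  - move=> x; apply: cvgB.
      by apply: cvgM; [exact: cvg_cst|exact: continuous_pow_normal_fun].
    by apply: cvgM; [exact: continuous_pow_normal_fun|exact: cvg_cst].
  - by rewrite fE; apply: integrableB => //; exact: integrableZl.
  - apply: (@cvg_pow_normal_fun m s k (fun n => n%:R)) => //.
    by under eq_fun do rewrite normr_nat; exact: cvgr_idn.
  - apply: (@cvg_pow_normal_fun m s k (fun n => - n%:R)) => //.
    by under eq_fun do rewrite normrN normr_nat; exact: cvgr_idn.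
under eq_integral do rewrite -[(f _)%:E]/((EFin \o f) _) fE.
rewrite integralB//; [|exact: integrableZl|exact: integrableZl].
rewrite !integralZl//.
have := integrable_fin_num measurableT i1.
have := integrable_fin_num measurableT i2.
case: integral => // a _; case: integral => // b _.
rewrite -!EFinM -EFinB => -[h]; congr EFin.
have -> : a = s ^+ 2 * ((s ^+ 2)^-1 * a) by rewrite mulrA divff// mul1r.
by rewrite (_ : _^-1 * a = k%:R * b); [ring|lra].
Qed.

Lemma ae_eq_normal_pdf m s :
  ae_eq mu setT (Radon_Nikodym_SigmaFinite.f (normal_prob m s) mu)
    (fun x => (normal_pdf m s x)%:E).
Proof.
have dom := normal_prob_dominates m s.
apply: integral_ae_eq => //.
- exact: Radon_Nikodym_SigmaFinite.f_integrable.
- by apply/measurable_EFinP; exact: measurable_normal_pdf.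
- by move=> A _ mA; rewrite -Radon_Nikodym_SigmaFinite.f_integral.
Qed.

Lemma ge0_integral_normal_prob m s (f : R -> \bar R) :
  measurable_fun setT f -> (forall x, 0 <= f x)%E ->
  (\int[normal_prob m s]_x f x = \int[mu]_x (f x * (normal_pdf m s x)%:E))%E.
Proof.
move=> mf f0; have dom := normal_prob_dominates m s.
rewrite -(Radon_Nikodym_SigmaFinite.change_of_variables dom)//.
apply: ae_eq_integral => //.
- apply: emeasurable_funM => //.
  exact: measurable_int (Radon_Nikodym_SigmaFinite.f_integrable dom).
- apply: emeasurable_funM => //.
  by apply/measurable_EFinP; exact: measurable_normal_pdf.
- by apply: ae_eqe_mul2l; exact: ae_eq_normal_pdf.
Qed.

Lemma integral_normal_prob m s (f : R -> R) :
  measurable_fun setT f ->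
  mu.-integrable setT (fun x => (f x * normal_pdf m s x)%:E) ->
  (normal_prob m s).-integrable setT (EFin \o f) /\
  (\int[normal_prob m s]_x (f x)%:E = \int[mu]_x (f x * normal_pdf m s x)%:E)%E.
Proof.
move=> mf int.
have intf : (normal_prob m s).-integrable setT (EFin \o f).
  apply/integrableP; split; first exact/measurable_EFinP.
  rewrite ge0_integral_normal_prob//; last first.
    by apply/measurable_EFinP/measurableT_comp.
  have /integrableP[_] := int; congr (_ < _)%E.
  apply: eq_integral => x _; rewrite /= -EFinM normrM.
  by rewrite (ger0_norm (normal_pdf_ge0 _ _ _)).
split => //.
rewrite -(Radon_Nikodym_change_of_variables (normal_prob_dominates m s))//.
apply: ae_eq_integral => //.
- apply: emeasurable_funM; first exact/measurable_EFinP.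
  apply: (measurable_int mu); apply: Radon_Nikodym_integrable.
  exact: normal_prob_dominates.
- exact: measurable_int int.
- under [X in ae_eq _ _ _ X]eq_fun do rewrite EFinM.
  apply: ae_eqe_mul2l.
  apply: ae_eq_trans (ae_eq_normal_pdf m s).
  apply: ae_eq_sym.
  exact: ae_eq_Radon_Nikodym_SigmaFinite (normal_prob_dominates m s) _ measurableT.
Qed.

Lemma normal_prob_moment m s k : s != 0 ->
  (normal_prob m s).-integrable setT (fun x => ((x - m) ^+ k)%:E) /\
  (\int[normal_prob m s]_x ((x - m) ^+ k)%:E = (s ^+ k * (gmom k)%:R)%:E)%E.
Proof.
move=> s0.
have pE : normal_pdf m s = (fun x => normal_peak s * normal_fun m s x).
  by apply/funext => x; rewrite /normal_pdf (negbTE s0).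
have fE j : (fun x => ((x - m) ^+ j * normal_pdf m s x)%:E) =
    (fun x => (normal_peak s)%:E * ((x - m) ^+ j * normal_fun m s x)%:E)%E.
  by apply/funext => x; rewrite pE -EFinM mulrCA.
have intp j := integrable_pow_normal_fun m j s0.
have [] := @integral_normal_prob m s (fun x => (x - m) ^+ k).
- by apply: measurable_funX; exact: measurable_funB.
- by rewrite fE; exact: integrableZl.
move=> h1 ->; split => // {h1}; rewrite fE integralZl//.
have key j : ((normal_peak s)%:E *
     (\int[mu]_x ((x - m) ^+ j.+1 * normal_fun m s x)%:E) =
   (j%:R * s ^+ 2)%:E * ((normal_peak s)%:E *
     \int[mu]_x ((x - m) ^+ j.-1 * normal_fun m s x)%:E))%E.
  by rewrite integral_pow_normal_funS// muleCA.
have k0 : ((normal_peak s)%:E *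
    (\int[mu]_x ((x - m) ^+ 0 * normal_fun m s x)%:E) = 1)%E.
  rewrite -integralZl// -fE -(integral_normal_pdf m s).
  by apply: eq_integral => x _; rewrite expr0 mul1r.
have [n] := ubnP k; elim: n k => // n IH [|[|k]] kn.
- by rewrite k0 /= mul1r.
- by rewrite key mul0r mul0e /= mulr0.
- rewrite key IH/=; last exact: (ltn_trans (ltnSn k) kn).
  by rewrite -EFinM natrM; congr EFin; rewrite !exprS; ring.
Qed.

End NormalMoments.

(** * Moments of the standard normal vector *)

Section Product.
Local Open Scope classical_set_scope.
Context d1 d2 (T1 : measurableType d1) (T2 : measurableType d2) (R : realType).
Variables (m1 : {sigma_finite_measure set T1 -> \bar R})
  (m2 : {sigma_finite_measure set T2 -> \bar R}).

Lemma integral_prod_mul (f : T1 -> R) (g : T2 -> R) :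
  m1.-integrable setT (EFin \o f) -> m2.-integrable setT (EFin \o g) ->
  (m1 \x m2)%E.-integrable setT (fun z => (f z.1 * g z.2)%:E) /\
  (\int[(m1 \x m2)%E]_z (f z.1 * g z.2)%:E =
   \int[m1]_x (f x)%:E * \int[m2]_y (g y)%:E)%E.
Proof.
move=> intf intg.
have mf : measurable_fun setT f.
  by apply/measurable_EFinP; exact: measurable_int intf.
have mg : measurable_fun setT g.
  by apply/measurable_EFinP; exact: measurable_int intg.
have int : (m1 \x m2)%E.-integrable setT (fun z => (f z.1 * g z.2)%:E).
  apply/integrable12ltyP.
    by apply/measurable_EFinP/measurable_funM; exact: measurableT_comp.
  have /integrableP[_ intf'] := intf; have /integrableP[_ intg'] := intg.
  under eq_integral => x _.
    under eq_integral do rewrite /= normrM EFinM.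
    rewrite ge0_integralZl//; last by apply/measurable_EFinP/measurableT_comp.
    over.
  rewrite ge0_integralZr//; last 2 first.
  - by apply/measurable_EFinP/measurableT_comp.
  - exact: integral_ge0.
  apply: lte_mul_pinfty => //; first exact: integral_ge0.
  by rewrite ge0_fin_numE//; exact: integral_ge0.
split=> //; rewrite -integral12_prod_meas1//.
have fin := integrable_fin_num measurableT intg.
rewrite /fubini_F /=.
under eq_integral => x _.
  under eq_integral do rewrite EFinM.
  rewrite integralZl//.
  over.
by rewrite -(fineK fin) integralZr.
Qed.
End Product.

Section StdNormal.
Local Open Scope classical_set_scope.
Variable R : realType.

Lemma measurable_monomial d (a : 'I_d -> nat) :
  measurable_fun setT (fun z : Rvec R d => \prod_i tnth z i ^+ a i).
Proof.
by apply: measurable_prod => i _; apply: measurable_funX; exact: measurable_tnth.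
Qed.

Lemma std_normal_moment d (a : 'I_d -> nat) :
  (std_normal d).-integrable setT
    (fun z : Rvec R d => (\prod_i tnth z i ^+ a i)%:E) /\
  (\int[std_normal d]_z (\prod_i tnth z i ^+ a i)%:E =
    ((\prod_i gmom (a i))%:R : R)%:E)%E.
Proof.
elim: d a => [|d IH] a.
  have -> : (fun z : Rvec R 0 => (\prod_i tnth z i ^+ a i)%:E) = cst 1%E.
    by apply/funext => z; rewrite big_ord0.
  rewrite big_ord0 integral_cst//= diracT mul1e; split => //.
  apply/integrableP; split => //.
  by rewrite /= integral_cst//= diracT mule1 normr1 ltry.
have [i1 e1] := IH (fun i => a (lift ord0 i)).
have [i2 e2] := @normal_prob_moment R 0 1 (a ord0) (oner_neq0 R).
have [i3 e3] := integral_prod_mul i2 i1.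
have E : (fun z : Rvec R d.+1 => (\prod_i tnth z i ^+ a i)%:E) \o @cons_vec R d =
   (fun z => ((z.1 - 0) ^+ a ord0 * \prod_i tnth z.2 i ^+ a (lift ord0 i))%:E).
  apply/funext => z /=; rewrite big_ord_recl tnth0 subr0; congr (_ * _)%:E.
  by apply: eq_bigr => i _; rewrite tnthS.
have mm := measurable_monomial a.
split.
  apply/integrable_pushforward => //; first exact/measurable_EFinP.
  by rewrite E.
rewrite integral_distribution; last 2 first.
- exact/measurable_EFinP.
- by rewrite E.
rewrite E.
by rewrite e3 e1 e2 expr1n mul1r -EFinM -natrM big_ord_recl.
Qed.
End StdNormal.

(** * The Gaussian functional on polynomials and integration by parts *)

Section MonomialFunctional.
Variables (n : nat) (A : comNzRingType).
Implicit Types (p q : mpoly n A) (g : multinom n -> A) (c e : 'I_n -> A).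

(** The linear functional with prescribed values g on monomials: when g gives
    the mixed moments of a random vector Y, this is p |-> E[p(Y)]. *)
Definition monfun g p : A := \sum_(a <- msupp p) mcoeff a p * g a.

Lemma monfun_sub g p (s : seq (multinom n)) : uniq s ->
  {subset msupp p <= s} -> monfun g p = \sum_(a <- s) mcoeff a p * g a.
Proof.
move=> us ps.
rewrite (bigID (mem (msupp p))) /= [X in _ + X]big1 ?addr0; last first.
  by move=> a; rewrite -mcoeff_eq0 => /eqP->; rewrite mul0r.
rewrite -big_filter; apply: perm_big; apply: uniq_perm.
- exact: msupp_uniq.
- exact: filter_uniq.
- by move=> a; rewrite mem_filter; case: (boolP (a \in msupp p)) => //= /ps ->.
Qed.

Lemma monfun_is_linear g : linear_for *%R (monfun g).
Proof.
move=> c p q.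
(* the supports of p, q and c p + q differ: sum over a common set of monomials *)
pose s := undup (msupp (c *: p + q) ++ msupp p ++ msupp q).
have us : uniq s by exact: undup_uniq.
have sub r : {subset msupp r <= msupp (c *: p + q) ++ msupp p ++ msupp q} ->
  {subset msupp r <= s} by move=> h a /h; rewrite mem_undup.
rewrite !(@monfun_sub g _ s)//; last 3 first.
- by apply: sub => a ha; rewrite !mem_cat ha !orbT.
- by apply: sub => a ha; rewrite !mem_cat ha !orbT.
- by apply: sub => a ha; rewrite !mem_cat ha.
rewrite mulr_sumr -big_split; apply: eq_bigr => a _ /=.
by rewrite mcoeffD mcoeffZ mulrDl mulrA.
Qed.

HB.instance Definition _ g :=
  GRing.isLinear.Build A (mpoly n A) A *%R (monfun g) (monfun_is_linear g).

Lemma monfunX g a : monfun g (mpolyX A a) = g a.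
Proof. by rewrite /monfun msuppX big_seq1 mcoeffX eqxx mul1r. Qed.

Definition gmoment (a : multinom n) : A := (\prod_i gmom (a i))%:R.

(** p |-> E[p(G)] for G standard normal, over any commutative ring. *)
Definition gauss : mpoly n A -> A := monfun gmoment.
HB.instance Definition _ := GRing.Linear.on gauss.

Lemma gaussX a : gauss (mpolyX A a) = gmoment a. Proof. exact: monfunX. Qed.

Lemma gauss1 : gauss 1 = 1.
Proof.
by rewrite -mpolyX0 /gauss monfunX /gmoment big1// => i _; rewrite mnm0E.
Qed.

(** Integration by parts, E[G_i p(G)] = E[(d_i p)(G)]: on a monomial it is the
    recurrence gmomS for the exponent of the i-th variable. *)
Lemma gauss_mulX i p : gauss (mpolyX A (mnm1 i) * p) = gauss (mderiv i p).
Proof.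
elim/mpolyind: p => [|c a p _ _ IH]; first by rewrite mulr0 !raddf0.
rewrite mulrDr mderivD !raddfD /= IH; congr (_ + _).
rewrite -scalerAr mderivZ !linearZ /=; congr (_ * _).
rewrite mderivX linearZ -mpolyXD /= !gaussX /gmoment -natrM.
rewrite (bigD1 i)//= [in RHS](bigD1 i)//= mulnA; congr (_ * _)%:R.
  by rewrite mnmDE mnmBE mnm1E eqxx add1n gmomS subn1.
apply: eq_bigr => j ji.
by rewrite mnmDE mnmBE mnm1E eq_sym (negbTE ji) add0n subn0.
Qed.

Definition linform c : mpoly n A := \sum_i c i *: mpolyX A (mnm1 i).

(** The derivation D_zeta of the linear form zeta = linform c: it maps linform e
    to the covariance of the two forms (dform_linform). *)
Definition dform c p : mpoly n A := \sum_i c i *: mderiv i p.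

Lemma meval_linform (v : 'I_n -> A) c : meval v (linform c) = \sum_i c i * v i.
Proof.
rewrite /linform raddf_sum; apply: eq_bigr => i _ /=.
by rewrite mevalZ mevalXU.
Qed.

Lemma meval_linform_pow d (v : 'I_n -> A) (z : 'I_d -> 'I_n -> A)
    (k : {ffun 'I_d -> nat}) :
  meval v (\prod_a linform (z a) ^+ k a) = \prod_a meval v (linform (z a)) ^+ k a.
Proof. by rewrite rmorph_prod; apply: eq_bigr => a _; rewrite rmorphXn. Qed.

Lemma gauss_linform c p : gauss (linform c * p) = gauss (dform c p).
Proof.
rewrite /linform /dform mulr_suml !raddf_sum; apply: eq_bigr => i _.
by rewrite /= -scalerAl !linearZ /= gauss_mulX.
Qed.

Lemma dformM c p q : dform c (p * q) = dform c p * q + p * dform c q.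
Proof.
rewrite /dform mulr_suml mulr_sumr -big_split; apply: eq_bigr => i _ /=.
by rewrite mderivM scalerDr scalerAl scalerAr.
Qed.

Lemma dform1 c : dform c 1 = 0.
Proof. by rewrite /dform big1// => i _; rewrite -mpolyC1 mderivC scaler0. Qed.

Lemma dform_linform c e : dform c (linform e) = (\sum_i c i * e i)%:A.
Proof.
rewrite /dform scaler_suml; apply: eq_bigr => i _.
have mX j : mderiv i (mpolyX A (mnm1 j)) = (j == i)%:R%:A.
  rewrite mderivX mnm1E; have [->|] := eqVneq j i; last by rewrite !scale0r.
  rewrite (_ : mnm_sub _ _ = mnm0) ?mpolyX0//.
  by apply/mnmP => l; rewrite mnmBE subnn mnm0E.
rewrite /linform (big_morph _ (@mderivD n A i) (mderiv0 A i)).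
rewrite (eq_bigr (fun j => (e j * (j == i)%:R)%:A)); last first.
  by move=> j _; rewrite mderivZ mX scalerA.
rewrite -scaler_suml (bigD1 i)//= eqxx mulr1.
by rewrite [X in _ + X]big1 ?addr0 ?scalerA// => j /negbTE->; rewrite mulr0.
Qed.

Lemma dformXn c p k : dform c (p ^+ k) = (p ^+ k.-1 * dform c p) *+ k.
Proof.
elim: k => [|k IH]; first by rewrite expr0 dform1 mulr0n.
rewrite exprS dformM IH [in RHS]mulrS mulrC; congr (_ + _).
by case: k {IH} => [|k]; rewrite ?mulr0n ?mulr0// mulrnAr mulrA -exprS.
Qed.

Lemma dform_prod0 c (I : finType) (P : pred I) (F : I -> mpoly n A) :
  (forall i, P i -> dform c (F i) = 0) -> dform c (\prod_(i | P i) F i) = 0.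
Proof.
move=> h; elim/big_rec: _ => [|i p Pi IH]; first exact: dform1.
by rewrite dformM IH h// mul0r mulr0 addr0.
Qed.

Lemma gauss_linform_exp c k :
  gauss (linform c ^+ k) = (\sum_i c i * c i) ^+ k./2 * (gmom k)%:R.
Proof.
have [N] := ubnP k; elim: N k => // N IH [|[|k]] kN.
- by rewrite expr0 gauss1 mul1r.
- by rewrite -[_ ^+ 1]mulr1 gauss_linform dform1 raddf0 mulr0.
rewrite exprS gauss_linform dformXn dform_linform.
rewrite raddfMn /= -scalerAr mulr1 linearZ /=.
rewrite IH; last exact: (ltn_trans (ltnSn k) kN).
by rewrite natrM exprS -mulr_natl; ring.
Qed.
End MonomialFunctional.

Section Biorthogonal.
Variables (N d : nat) (A : comNzRingType).
Variables (xi eta : 'I_d -> 'I_N -> A).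
Let dot (c e : 'I_N -> A) := \sum_i c i * e i.
Hypothesis xi_xi : forall a b, dot (xi a) (xi b) = 0.
Hypothesis eta_eta : forall a b, dot (eta a) (eta b) = 0.
Hypothesis xi_eta : forall a b, dot (xi a) (eta b) = (a == b)%:R.

Local Notation pw z n := (\prod_a linform (z a) ^+ n a).

Definition decr (a : 'I_d) (n : {ffun 'I_d -> nat}) : {ffun 'I_d -> nat} :=
  [ffun j => if j == a then (n j).-1 else n j].

Lemma linform_pow_decr (z : 'I_d -> 'I_N -> A) (n : {ffun 'I_d -> nat}) a :
  (0 < n a)%N -> pw z n = linform (z a) * pw z (decr a n).
Proof.
move=> na; rewrite (bigD1 a)//= [in RHS](bigD1 a)//= ffunE eqxx mulrA -exprS.
rewrite prednK//; congr (_ * _).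
by apply: eq_bigr => j /negbTE ja; rewrite ffunE ja.
Qed.

Lemma dform_pow0 c (z : 'I_d -> 'I_N -> A) (n : {ffun 'I_d -> nat})
    (P : pred 'I_d) :
  (forall a, P a -> dot c (z a) = 0) ->
  dform c (\prod_(a | P a) linform (z a) ^+ n a) = 0.
Proof.
move=> h; apply: dform_prod0 => a Pa.
by rewrite dformXn dform_linform -/(dot _ _) h// scale0r mulr0 mul0rn.
Qed.

Lemma dform_xi_eta (m : {ffun 'I_d -> nat}) a :
  dform (xi a) (pw eta m) = pw eta (decr a m) *+ m a.
Proof.
rewrite (bigD1 a)//= dformM dform_pow0 => [|b ba]; last first.
  by rewrite xi_eta eq_sym (negbTE ba).
rewrite mulr0 addr0 dformXn dform_linform -/(dot _ _) xi_eta eqxx scale1r mulr1.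
rewrite mulrnAl; congr (_ *+ _).
rewrite [in RHS](bigD1 a)//= ffunE eqxx; congr (_ * _).
by apply: eq_bigr => j /negbTE ja; rewrite ffunE ja.
Qed.

(** Each xi can only be paired with the eta of the same index, so integration by
    parts on a factor xi_a lowers both n_a and m_a and yields the factor m_a.
    When no xi is left, the same step on a remaining eta gives 0. *)
Lemma gauss_biorthogonal (n m : {ffun 'I_d -> nat}) :
  gauss (pw xi n * pw eta m) = if n == m then (\prod_j (n j)`!)%:R else 0.
Proof.
have [K] := ubnP (\sum_j n j)%N; elim: K n m => // K IH n m nK.
have [a na|n0] := pickP (fun a => 0 < n a)%N; last first.
  have {}n0 j : n j = 0%N by apply/eqP; rewrite -leqn0 leqNgt n0.
  have -> : pw xi n = 1 by rewrite big1// => j _; rewrite n0.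
  rewrite mul1r.
  have [b mb|m0] := pickP (fun a => 0 < m a)%N; last first.
    have {}m0 j : m j = 0%N by apply/eqP; rewrite -leqn0 leqNgt m0.
    have -> : n = m by apply/ffunP => j; rewrite n0 m0.
    by rewrite eqxx !big1 ?gauss1// => j _; rewrite m0.
  rewrite (@linform_pow_decr _ _ b)// gauss_linform dform_pow0 ?raddf0//.
  by case: eqP => // nm; move: mb; rewrite -nm n0.
rewrite (@linform_pow_decr _ _ a)// -mulrA gauss_linform dformM dform_pow0//.
rewrite mul0r add0r dform_xi_eta mulrnAr raddfMn /= IH; last first.
  rewrite -ltnS (leq_trans _ nK)// ltnS (bigD1 a)//= [leqRHS](bigD1 a)//=.
  rewrite ffunE eqxx -addSn prednK// leq_add2l; apply: leq_sum => j /negbTE ja.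
  by rewrite ffunE ja.
have [ma|ma] := posnP (m a).
  by rewrite ma mulr0n; case: eqP => // nm; rewrite nm ma in na.
have -> : (decr a n == decr a m) = (n == m).
  apply/eqP/eqP => [/ffunP h|->//]; apply/ffunP => j.
  have := h j; rewrite !ffunE; case: eqP => // ->.
  by move=> e; rewrite -(prednK na) -(prednK ma) e.
case: eqP => [nm|]; last by rewrite mul0rn.
rewrite -[LHS]mulr_natr -natrM -nm; congr (_%:R).
rewrite mulnC [in RHS](bigD1 a)//= (bigD1 a)//= ffunE eqxx mulnA; congr (_ * _)%N.
  by rewrite -{1 3}(prednK na) factS.
by apply: eq_bigr => j /negbTE ja; rewrite ffunE ja.
Qed.

End Biorthogonal.

(** * Polarization *)

Lemma poly_eq0_nat (K : numDomainType) (p : {poly K}) :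
  (forall k : nat, p.[k%:R] = 0) -> p = 0.
Proof.
move=> h; apply/eqP; have [//|p0] := eqVneq p 0.
have := max_poly_roots p0 (rs := [seq i%:R | i <- iota 0 (size p)]).
rewrite size_map size_iota ltnn => -> //.
  by apply/allP => x /mapP[i _ ->]; apply/rootP.
by rewrite map_inj_uniq ?iota_uniq// => i j /eqP; rewrite eqr_nat => /eqP.
Qed.

Section Polarization.
Variables (n : nat) (K : numFieldType) (F : {linear mpoly n K -> K | *%R}).
Hypothesis F0 : forall (c : 'I_n -> K) k, F (linform c ^+ k) = 0.

(** One variable at a time is extracted from a power of a linear form L: the
    function e |-> F (q (L + e X)^(k+1)) is a polynomial in e that vanishes
    identically, and its linear coefficient is (k + 1) F (q X L^k). *)
Lemma polarization_seq (s : seq 'I_n) c k :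
  F (\prod_(i <- s) mpolyX K (mnm1 i) * linform c ^+ k) = 0.
Proof.
elim: s c k => [|i s IH] c k; first by rewrite big_nil mul1r.
rewrite big_cons; set q := \prod_(j <- s) _; set L := linform c.
set X := mpolyX K _.
pose p := \poly_(j < k.+2) F (q * (L ^+ (k.+1 - j) * X ^+ j) *+ 'C(k.+1, j)).
suff p0 : p = 0.
  have := coef0 K 1; rewrite -{1}p0 coef_poly/= bin1 subn1 expr1 raddfMn /=.
  by move/eqP; rewrite mulrn_eq0 /= => /eqP <-; congr (F _); ring.
apply: poly_eq0_nat => e.
rewrite horner_poly.
have := IH (fun j => c j + e%:R * (j == i)%:R) k.+1.
have -> : linform (fun j => c j + e%:R * (j == i)%:R) = L + e%:R *: X.
  rewrite /linform /L /linform; under eq_bigr do rewrite scalerDl.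
  rewrite big_split /=; congr (_ + _).
  rewrite (bigD1 i)//= eqxx mulr1 big1 ?addr0// => j /negbTE->.
  by rewrite mulr0 scale0r.
rewrite exprDn mulr_sumr raddf_sum /= => h.
rewrite -[RHS]h; apply: eq_bigr => j _.
by rewrite exprZn -scalerAr scalerMnr -scalerAr linearZ /= mulrnAr raddfMn mulrC.
Qed.

(** The powers of linear forms span all polynomials. *)
Lemma polarization : F =1 fun=> 0.
Proof.
elim/mpolyind => [|c a p _ _ IH]; first by rewrite raddf0.
rewrite raddfD /= IH addr0 linearZ /=.
suff -> : F (mpolyX K a) = 0 by rewrite mulr0.
suff [s ->] : exists s, mpolyX K a = \prod_(i <- s) mpolyX K (mnm1 i).
  by have := polarization_seq s (fun=> 0) 0; rewrite expr0 mulr1.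
rewrite mpolyXE_id.
elim: (index_enum _) => [|i r [s IHs]]; first by exists [::]; rewrite !big_nil.
exists (nseq (a i) i ++ s); rewrite big_cons IHs big_cat; congr (_ * _).
by elim: (a i) => [|k IHk]; rewrite ?big_nil// exprS IHk big_cons.
Qed.
End Polarization.

(** * Square roots of positive semidefinite matrices *)

(** Cholesky factorization, by induction on the size: the Schur complement
    W - a^-1 b^T b of the corner a is again positive semidefinite. A zero corner
    forces b = 0, and with the convention 0^-1 = 0 the same formulas then
    remain correct. *)
Lemma psd_root (R : rcfType) d (V : 'M[R]_d) :
  V^T = V -> (forall t : 'rV_d, 0 <= (t *m V *m t^T) 0 0) ->
  exists B : 'M[R]_d, B *m B^T = V.
Proof.
elim: d V => [|d IH] V symV psdV; first by exists 0; rewrite [LHS]flatmx0 [RHS]flatmx0.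
rewrite -[d.+1]/(1 + d)%N in V symV psdV *.
pose a := ulsubmx V 0 0; pose b := ursubmx V; pose W := drsubmx V.
have dlE : dlsubmx V = b^T by rewrite /b trmx_ursub symV.
have WT : W^T = W by rewrite /W trmx_drsub symV.
have aE : ulsubmx V = a%:M by rewrite [LHS]mx11_scalar.
have VE : V = block_mx a%:M b b^T W by rewrite -(submxK V) aE dlE.
have addE (M N : 'M[R]_1) : (M + N) 0 0 = M 0 0 + N 0 0 by rewrite mxE.
have zE : (0 : 'M[R]_1) 0 0 = 0 by rewrite mxE.
have oppE (M : 'M[R]_1) : (- M) 0 0 = - (M 0 0) by rewrite mxE.
have sclE (c : R) (M : 'M[R]_1) : (c *: M) 0 0 = c * M 0 0 by rewrite mxE.
have cstE (c : R) : (c%:M : 'M[R]_1) 0 0 = c by rewrite mxE mulr1n.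
have q (x : R) (u : 'rV_d) : (row_mx x%:M u *m V *m (row_mx x%:M u)^T) 0 0 =
    x ^+ 2 * a + 2 * x * (u *m b^T) 0 0 + (u *m W *m u^T) 0 0.
  have bu : (b *m u^T) 0 0 = (u *m b^T) 0 0.
    by rewrite -[in RHS](trmxK u) -trmx_mul [RHS]mxE.
  rewrite VE mul_row_block tr_row_mx mul_row_col tr_scalar_mx !mul_scalar_mx.
  rewrite mul_mx_scalar !mulmxDl -scalemxAl scale_scalar_mx.
  by rewrite !(addE, sclE) cstE bu; ring.
have a0 : 0 <= a.
  by have := psdV (row_mx 1%:M 0); rewrite q !mul0mx !zE; lra.
have b0 : a = 0 -> b = 0.
  move=> az; apply/rowP => j; rewrite [RHS]mxE.
  apply/eqP; apply: contraT => bj.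
  pose u : 'rV[R]_d := delta_mx 0 j.
  have ub : (u *m b^T) 0 0 = b 0 j.
    by rewrite /u -rowE 2!mxE.
  (* the form is affine in x, with slope 2 b_j: choose x so that it equals -1 *)
  have := psdV (row_mx (- ((u *m W *m u^T) 0 0 + 1) / (2 * b 0 j))%:M u).
  rewrite q az mulr0 add0r ub.
  set w := (u *m W *m u^T) 0 0.
  have -> : 2 * (- (w + 1) / (2 * b 0 j)) * b 0 j = - (w + 1).
    by field; rewrite bj.
  lra.
pose s := Num.sqrt a.
have ss : s * s = a by rewrite -expr2 sqr_sqrtr.
have sbE : s *: (s^-1 *: b) = b.
  rewrite scalerA; have [s0|s0] := eqVneq s 0; last by rewrite divff// scale1r.
  by rewrite b0 ?scaler0// -ss s0 mul0r.
have [| |B BE] := IH (W - a^-1 *: (b^T *m b)).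
- by rewrite linearB linearZ /= trmx_mul trmxK WT.
- (* this x minimizes the form on the vectors (x, u) *)
  move=> u; pose x := - (a^-1 * (u *m b^T) 0 0).
  have := psdV (row_mx x%:M u); rewrite q.
  rewrite mulmxBr mulmxBl addE.
  have -> : (- (u *m (a^-1 *: (b^T *m b)) *m u^T)) 0 0 =
      - (a^-1 * (u *m b^T) 0 0 ^+ 2).
    have bbE : u *m (b^T *m b) *m u^T = (u *m b^T) *m (b *m u^T).
      by rewrite !mulmxA.
    rewrite -scalemxAr -scalemxAl bbE {1}[u *m b^T]mx11_scalar mul_scalar_mx.
    have bu : (b *m u^T) 0 0 = (u *m b^T) 0 0.
      by rewrite -[in RHS](trmxK u) -trmx_mul [RHS]mxE.
    by rewrite oppE !sclE bu.
  suff -> : x ^+ 2 * a + 2 * x * (u *m b^T) 0 0 = - (a^-1 * (u *m b^T) 0 0 ^+ 2).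
    by rewrite addrC.
  rewrite /x; have [->|an0] := eqVneq a 0; first by rewrite invr0; ring.
  by field.
exists (block_mx s%:M 0 (s^-1 *: b^T) B).
have tE : (s^-1 *: b^T)^T = s^-1 *: b by rewrite linearZ /= trmxK.
rewrite tr_block_mx mulmx_block VE !trmx0 tr_scalar_mx tE.
rewrite !mul0mx !mulmx0 !addr0 mul_scalar_mx scale_scalar_mx ss mul_scalar_mx sbE.
rewrite mul_mx_scalar BE.
have -> : s^-1 *: b^T *m (s^-1 *: b) = a^-1 *: (b^T *m b).
  by rewrite -scalemxAl -scalemxAr scalerA -ss invfM.
have -> : s *: (s^-1 *: b^T) = b^T.
  by have := congr1 trmx sbE; rewrite linearZ /= [(_ *: b)^T]linearZ.
by rewrite addrC subrK.
Qed.

Lemma mx_root_invmx (R : realType) d (V : 'M[R]_d) : V \in unitmx ->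
  mx_root V *m (mx_root V)^T = V ->
  mx_root (invmx V) *m (mx_root (invmx V))^T = invmx V.
Proof.
move=> uV BE; set B := mx_root V in BE.
have uB : B \in unitmx by move: uV; rewrite -BE unitmx_mul => /andP[].
apply: (@xgetPex _ 0 [set A | A *m A^T = invmx V]%classic).
exists (invmx B)^T; rewrite /= trmxK trmx_inv.
have e : invmx B^T *m invmx B *m V = 1%:M.
  by rewrite -BE mulmxA -(mulmxA _ _ B) mulVmx// mulmx1 mulVmx// unitmx_tr.
by rewrite -[LHS]mulmx1 -(mulmxV uV) mulmxA e mul1mx.
Qed.

(** * Linearity of real and complex expectations *)

Section Expectation.
Local Open Scope classical_set_scope.
Context d (T : measurableType d) (R : realType) (P : probability T R).
Implicit Types f g : T -> R.

Definition rintegrable f := P.-integrable setT (EFin \o f).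

Lemma rintegrable_sum I (s : seq I) (c : I -> R) (r : I -> T -> R) :
  (forall i, rintegrable (r i)) ->
  rintegrable (fun w => \sum_(i <- s) c i * r i w).
Proof.
move=> ir; rewrite /rintegrable.
have -> : EFin \o (fun w => \sum_(i <- s) c i * r i w) =
    (fun w => \sum_(i <- s) (c i)%:E * (r i w)%:E)%E.
  by apply/funext => w /=; rewrite -sumEFin; apply: eq_bigr => i _; rewrite EFinM.
by apply: integrable_sum => // i _; apply: integrableZl => //; exact: ir.
Qed.

Lemma expectation_lin I (s : seq I) (c : I -> R) (r : I -> T -> R) :
  (forall i, rintegrable (r i)) ->
  fine ('E_P[(fun w => \sum_(i <- s) c i * r i w)%R])%E =
  \sum_(i <- s) c i * fine ('E_P[r i])%E.
Proof.
move=> ir; rewrite unlock.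
have -> : (fun w => (\sum_(i <- s) c i * r i w)%:E) =
    (fun w => \sum_(i <- s) (c i)%:E * (r i w)%:E)%E.
  by apply/funext => w /=; rewrite -sumEFin; apply: eq_bigr => i _; rewrite EFinM.
rewrite integral_sum//; last by move=> i; apply: integrableZl => //; exact: ir.
rewrite -sum_fine; last first.
  move=> i _; rewrite integralZl//; last exact: ir.
  by rewrite fin_numM//; apply: integrable_fin_num => //; exact: ir.
apply: eq_bigr => i _; rewrite integralZl//; last exact: ir.
by rewrite fineM//; apply: integrable_fin_num => //; exact: ir.
Qed.

(** Unlike integrability, this is stable under products (has_momentsM). *)
Definition has_moments f :=
  measurable_fun setT f /\ forall k, rintegrable (fun w => f w ^+ k).

Lemma has_moments1 : has_moments (cst 1).
Proof.
split => // k; rewrite /rintegrable /=; under eq_fun do rewrite expr1n.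
exact: finite_measure_integrable_cst.
Qed.

(** |f g|^k <= f^(2 k) + g^(2 k). *)
Lemma has_momentsM f g : has_moments f -> has_moments g ->
  has_moments (fun w => f w * g w).
Proof.
move=> [mf hf] [mg hg]; split; first exact: measurable_funM.
move=> k; have := integrableD measurableT (hf (2 * k)%N) (hg (2 * k)%N).
apply: le_integrable => //.
  by apply/measurable_EFinP/measurable_funX/measurable_funM.
move=> w _ /=; rewrite lee_fin exprMn normrM !exprM.
set a := f w; set b := g w.
have h x : (x ^+ 2) ^+ k = `|x ^+ k| ^+ 2 :> R.
  by rewrite exprAC -real_normK ?num_real.
rewrite !h; apply: le_trans (ler_norm _).
move: `|a ^+ k| `|b ^+ k| (normr_ge0 (a ^+ k)) (normr_ge0 (b ^+ k)) => u v u0 v0.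
have := sqr_ge0 (u - v); have := mulr_ge0 u0 v0; nra.
Qed.

Lemma has_momentsX f k : has_moments f -> has_moments (fun w => f w ^+ k).
Proof.
move=> hf; elim: k => [|k IH]; first exact: has_moments1.
by under eq_fun do rewrite exprS; exact: has_momentsM.
Qed.

Lemma has_moments_prod (I : Type) (s : seq I) (f : I -> T -> R) :
  (forall i, has_moments (f i)) -> has_moments (fun w => \prod_(i <- s) f i w).
Proof.
move=> hf; elim: s => [|i s IH].
  by under eq_fun do rewrite big_nil; exact: has_moments1.
by under eq_fun do rewrite big_cons; exact: has_momentsM.
Qed.

Lemma has_moments_integrable f : has_moments f -> rintegrable f.
Proof. by move=> [_ /(_ 1%N)]. Qed.

End Expectation.

Section CExpectation.
Local Open Scope complex_scope.
Context d (T : measurableType d) (R : realType) (P : probability T R).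

Let ReM (z : R[i]) x : complex.Re (z * x%:C) = complex.Re z * x.
Proof. by case: z => a b /=; rewrite mulr0 subr0. Qed.

Let ImM (z : R[i]) x : complex.Im (z * x%:C) = complex.Im z * x.
Proof. by case: z => a b /=; rewrite mulr0 add0r. Qed.

Let Re_sum I (s : seq I) (F : I -> R[i]) :
  complex.Re (\sum_(i <- s) F i) = \sum_(i <- s) complex.Re (F i).
Proof. by apply: (big_morph (@complex.Re R)) => [[a b] []|]. Qed.

Let Im_sum I (s : seq I) (F : I -> R[i]) :
  complex.Im (\sum_(i <- s) F i) = \sum_(i <- s) complex.Im (F i).
Proof. by apply: (big_morph (@complex.Im R)) => [[a b] []|]. Qed.

Let Re_comb I (s : seq I) (c : I -> R[i]) (r : I -> T -> R) :
  (fun w => complex.Re (\sum_(i <- s) c i * (r i w)%:C)) =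
  (fun w => \sum_(i <- s) complex.Re (c i) * r i w).
Proof. by apply/funext => w; rewrite Re_sum; apply: eq_bigr => i _; rewrite ReM. Qed.

Let Im_comb I (s : seq I) (c : I -> R[i]) (r : I -> T -> R) :
  (fun w => complex.Im (\sum_(i <- s) c i * (r i w)%:C)) =
  (fun w => \sum_(i <- s) complex.Im (c i) * r i w).
Proof. by apply/funext => w; rewrite Im_sum; apply: eq_bigr => i _; rewrite ImM. Qed.

Lemma cexpectation_sum I (s : seq I) (c : I -> R[i]) (r : I -> T -> R) :
  (forall i, rintegrable P (r i)) ->
  cexpectation P (fun w => \sum_(i <- s) c i * (r i w)%:C) =
    \sum_(i <- s) c i * (fine ('E_P[r i])%E)%:C.
Proof.
move=> ir; rewrite /cexpectation Re_comb Im_comb !expectation_lin//.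
apply/eqP; rewrite eq_complex Re_sum Im_sum /=.
by apply/andP; split; apply/eqP; apply: eq_bigr => i _; rewrite ?ReM ?ImM.
Qed.

Definition cintegrable (f : T -> R[i]) :=
  rintegrable P (fun w => complex.Re (f w)) /\
  rintegrable P (fun w => complex.Im (f w)).

Lemma cintegrable_sum I (s : seq I) (c : I -> R[i]) (r : I -> T -> R) :
  (forall i, rintegrable P (r i)) ->
  cintegrable (fun w => \sum_(i <- s) c i * (r i w)%:C).
Proof.
by move=> ir; rewrite /cintegrable Re_comb Im_comb; split; exact: rintegrable_sum.
Qed.

Lemma cexpectationZ (c : R[i]) f : cintegrable f ->
  cexpectation P (fun w => c * f w) = c * cexpectation P f.
Proof.
move=> [hr hi].
pose r (b : bool) w := if b then complex.Re (f w) else complex.Im (f w).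
pose e (b : bool) : R[i] := if b then 1 else 'i.
have hR b : rintegrable P (r b) by case: b.
have fE w : f w = \sum_(b <- [:: true; false]) e b * (r b w)%:C.
  by rewrite big_cons big_seq1 mul1r -complexE.
have -> : (fun w => c * f w) =
    (fun w => \sum_(b <- [:: true; false]) (c * e b) * (r b w)%:C).
  by apply/funext => w; rewrite fE mulr_sumr; under eq_bigr do rewrite mulrA.
rewrite (funext fE) !cexpectation_sum// mulr_sumr.
by under eq_bigr do rewrite -mulrA.
Qed.

End CExpectation.

(** * Expectations of polynomials as functions of the mixed moments *)

Section Moments.
Local Open Scope complex_scope.
Context d' (T : measurableType d') (R : realType) (P : probability T R) (d : nat).
Variable Y : T -> 'I_d -> R.

Definition mixed_moments :=
  forall a : 'I_d -> nat, rintegrable P (fun w => \prod_i Y w i ^+ a i).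

Definition moment (a : 'I_d -> nat) : R :=
  fine ('E_P[(fun w => \prod_i Y w i ^+ a i)%R])%E.

Hypothesis hY : mixed_moments.

Lemma rintegrable_meval (p : mpoly d R) :
  rintegrable P (fun w => meval (Y w) p).
Proof. by under eq_fun do rewrite mevalE; exact: rintegrable_sum. Qed.

Lemma expectation_meval (p : mpoly d R) :
  fine ('E_P[(fun w => meval (Y w) p)%R])%E = monfun moment p.
Proof. by under eq_fun do rewrite mevalE; rewrite expectation_lin. Qed.

Lemma cintegrable_meval (p : mpoly d R[i]) :
  cintegrable P (fun w => meval (fun i => (Y w i)%:C) p).
Proof.
have -> : (fun w => meval (fun i => (Y w i)%:C) p) =
  (fun w => \sum_(a <- msupp p) mcoeff a p * (\prod_i Y w i ^+ a i)%:C).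
  apply/funext => w; rewrite mevalE; apply: eq_bigr => a _.
  by rewrite rmorph_prod; congr (_ * _); apply: eq_bigr => i _; rewrite rmorphXn.
exact: cintegrable_sum.
Qed.

End Moments.

Definition cat3 d (A : Type) (x y z : 'I_d -> A) (i : 'I_(d + (d + d))) : A :=
  match fintype.split i with
  | inl j => x j
  | inr k => match fintype.split k with inl j => y j | inr j => z j end
  end.

Section Cat3.
Local Open Scope complex_scope.
Variable d : nat.

Section Entries.
Variables (A : Type) (x y z : 'I_d -> A) (j : 'I_d).

Lemma cat3_1 : cat3 x y z (lshift _ j) = x j.
Proof. by rewrite /cat3 (unsplitK (inl j)). Qed.

Lemma cat3_2 : cat3 x y z (rshift d (lshift d j)) = y j.
Proof. by rewrite /cat3 (unsplitK (inr (lshift d j))) (unsplitK (inl j)). Qed.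

Lemma cat3_3 : cat3 x y z (rshift d (rshift d j)) = z j.
Proof. by rewrite /cat3 (unsplitK (inr (rshift d j))) (unsplitK (inr j)). Qed.
End Entries.

Lemma dot_cat3 (A : comNzRingType) (u v w u' v' w' : 'I_d -> A) :
  \sum_i cat3 u v w i * cat3 u' v' w' i =
  \sum_j u j * u' j + (\sum_j v j * v' j + \sum_j w j * w' j).
Proof.
rewrite !big_split_ord /=; congr (_ + (_ + _)); apply: eq_bigr => j _.
- by rewrite !cat3_1.
- by rewrite !cat3_2.
- by rewrite !cat3_3.
Qed.

Lemma cat3_complex (R : realType) (x y z : 'I_d -> R) i :
  (cat3 x y z i)%:C =
  cat3 (fun j => (x j)%:C) (fun j => (y j)%:C) (fun j => (z j)%:C) i.
Proof. by rewrite /cat3; case: fintype.split => // k; case: fintype.split. Qed.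

Lemma meval_cat3 (R : realType) (u v w : 'I_d -> R[i]) (x y z : 'I_d -> R) :
  meval (fun i => (cat3 x y z i)%:C) (linform (cat3 u v w)) =
  \sum_j u j * (x j)%:C + (\sum_j v j * (y j)%:C + \sum_j w j * (z j)%:C).
Proof.
by rewrite meval_linform; under eq_bigr do rewrite cat3_complex; rewrite dot_cat3.
Qed.

Definition moment3 (R : realType) (m1 m2 m3 : ('I_d -> nat) -> R)
    (a : multinom (d + (d + d))) : R[i] :=
  (m1 (fun j => a (lshift _ j)) * m2 (fun j => a (rshift d (lshift d j))) *
   m3 (fun j => a (rshift d (rshift d j))))%:C.
End Cat3.

Section Triple.
Local Open Scope complex_scope.
Context d1 d2 d3 (T1 : measurableType d1) (T2 : measurableType d2)
  (T3 : measurableType d3) (R : realType).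
Variables (P1 : probability T1 R) (P2 : probability T2 R) (P3 : probability T3 R).
Variables (d : nat) (Y1 : T1 -> 'I_d -> R) (Y2 : T2 -> 'I_d -> R)
  (Y3 : T3 -> 'I_d -> R).
Hypotheses (h1 : mixed_moments P1 Y1) (h2 : mixed_moments P2 Y2)
  (h3 : mixed_moments P3 Y3).

(** Successive expectations of a polynomial in three independent vectors are
    computed monomial by monomial, which spares a product measure and Fubini.
    In particular only the mixed moments of each vector matter. *)
Lemma cexpectation3 (p : mpoly (d + (d + d)) R[i]) :
  cexpectation P1 (fun w1 => cexpectation P2 (fun w2 => cexpectation P3 (fun w3 =>
    meval (fun i => (cat3 (Y1 w1) (Y2 w2) (Y3 w3) i)%:C) p))) =
  monfun (moment3 (moment P1 Y1) (moment P2 Y2) (moment P3 Y3)) p.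
Proof.
pose z1 w (a : multinom (d + (d + d))) := \prod_i Y1 w i ^+ a (lshift _ i).
pose z2 w (a : multinom (d + (d + d))) :=
  \prod_i Y2 w i ^+ a (rshift d (lshift d i)).
pose z3 w (a : multinom (d + (d + d))) :=
  \prod_i Y3 w i ^+ a (rshift d (rshift d i)).
pose M2 (a : multinom (d + (d + d))) :=
  moment P2 Y2 (fun j => a (rshift d (lshift d j))).
pose M3 (a : multinom (d + (d + d))) :=
  moment P3 Y3 (fun j => a (rshift d (rshift d j))).
have E w1 w2 w3 : meval (fun i => (cat3 (Y1 w1) (Y2 w2) (Y3 w3) i)%:C) p =
    \sum_(a <- msupp p) (mcoeff a p * (z1 w1 a * z2 w2 a)%:C) * (z3 w3 a)%:C.
  rewrite mevalE; apply: eq_bigr => a _; rewrite -mulrA -rmorphM; congr (_ * _).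
  rewrite !big_split_ord /= -mulrA !rmorphM !rmorph_prod; congr (_ * (_ * _));
  by apply: eq_bigr => i _; rewrite rmorphXn /= ?cat3_1 ?cat3_2 ?cat3_3.
have E3 w1 w2 : cexpectation P3 (fun w3 =>
    meval (fun i => (cat3 (Y1 w1) (Y2 w2) (Y3 w3) i)%:C) p) =
    \sum_(a <- msupp p)
      (mcoeff a p * (z1 w1 a)%:C * (M3 a)%:C) * (z2 w2 a)%:C.
  rewrite (funext (E w1 w2)) cexpectation_sum; last by move=> a; exact: h3.
  by apply: eq_bigr => a _; rewrite rmorphM /M3 /moment /z3; ring.
have E2 w1 : cexpectation P2 (fun w2 => cexpectation P3 (fun w3 =>
    meval (fun i => (cat3 (Y1 w1) (Y2 w2) (Y3 w3) i)%:C) p)) =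
    \sum_(a <- msupp p) (mcoeff a p * (M2 a)%:C * (M3 a)%:C) * (z1 w1 a)%:C.
  rewrite (funext (E3 w1)) cexpectation_sum; last by move=> a; exact: h2.
  by apply: eq_bigr => a _; rewrite /M2 /moment /z2; ring.
rewrite (funext E2) cexpectation_sum; last by move=> a; exact: h1.
apply: eq_bigr => a _.
by rewrite /moment3 !rmorphM /M2 /M3 /moment /z1 /=; ring.
Qed.
End Triple.

(** * Moments of Gaussian vectors *)

Section StdLinear.
Local Open Scope classical_set_scope.
Variables (R : realType) (d : nat).
Implicit Types (z : Rvec R d) (A V : 'M[R]_d).

Definition vcoord z : 'I_d -> R := tnth z.

Definition lincoord A z (i : 'I_d) : R := \sum_j A i j * tnth z j.

Lemma tnth_lin_vec A z i : tnth (lin_vec A z) i = lincoord A z i.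
Proof. by rewrite tnth_mktuple mxE; apply: eq_bigr => j _; rewrite mxE. Qed.

Lemma mixed_moments_std : mixed_moments (std_normal d) vcoord.
Proof. by move=> a; have [] := @std_normal_moment R d a. Qed.

Lemma moment_std a : moment (std_normal d) vcoord a = (\prod_i gmom (a i))%:R.
Proof. by rewrite /moment unlock (@std_normal_moment R d a).2. Qed.

Lemma moment3_std :
  moment3 (moment (std_normal d) vcoord) (moment (std_normal d) vcoord)
    (moment (std_normal d) vcoord) = @gmoment (d + (d + d)) R[i].
Proof.
apply/funext => a; rewrite /moment3 !moment_std /gmoment -!natrM rmorph_nat.
by rewrite !big_split_ord /= mulnA.
Qed.

Lemma mixed_moments_lin A : mixed_moments (std_normal d) (lincoord A).
Proof.
move=> a.
have -> : (fun z => \prod_i lincoord A z i ^+ a i) =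
   (fun z => meval (vcoord z) (\prod_i linform (A i) ^+ a i)).
  apply/funext => z; rewrite rmorph_prod; apply: eq_bigr => i _.
  by rewrite rmorphXn /= meval_linform.
by apply: rintegrable_meval; exact: mixed_moments_std.
Qed.

Lemma mvnormal_moment V : mixed_moments (mvnormal V) vcoord /\
  forall a, moment (mvnormal V) vcoord a =
    moment (std_normal d) (lincoord (mx_root V)) a.
Proof.
have mm a : measurable_fun setT (fun z => (\prod_i vcoord z i ^+ a i)%:E).
  by apply/measurable_EFinP; exact: measurable_monomial.
have E a : (fun z => (\prod_i vcoord z i ^+ a i)%:E) \o lin_vec (mx_root V) =
    (fun z => (\prod_i lincoord (mx_root V) z i ^+ a i)%:E).
  apply/funext => z /=; congr EFin; apply: eq_bigr => i _.
  by rewrite /vcoord tnth_lin_vec.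
split=> a.
  apply/integrable_pushforward => //; first exact: mm.
  by rewrite E; exact: mixed_moments_lin.
rewrite /moment unlock integral_distribution ?E//.
exact: mixed_moments_lin.
Qed.
End StdLinear.

Section Law.
Local Open Scope classical_set_scope.
Context d (T : measurableType d) (R : realType) (P : probability T R).

Lemma integral_law (Y : T -> R) (nu : probability (measurableTypeR R) R)
    (f : R -> R) :
  measurable_fun setT Y ->
  (forall B : set (measurableTypeR R), measurable B -> P (Y @^-1` B) = nu B) ->
  measurable_fun setT f -> nu.-integrable setT (EFin \o f) ->
  rintegrable P (f \o Y) /\ ('E_P[f \o Y] = \int[nu]_y (f y)%:E)%E.
Proof.
move=> mY law mf intf.
pose Y0 : T -> measurableTypeR R := Y.
have mY0 : measurable_fun setT Y0 by exact: mY.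
pose Y' : {RV P >-> measurableTypeR R} := mfun_Sub (mem_set mY0).
have eqm (g : R -> \bar R) : (\int[distribution P Y']_y g y = \int[nu]_y g y)%E.
  by apply: eq_measure_integral => A mA _; exact: law.
have int : rintegrable P (f \o Y).
  apply/integrableP; split; first exact/measurable_EFinP/measurableT_comp.
  have /integrableP[_] := intf; rewrite -eqm ge0_integral_distribution//.
  by apply: measurableT_comp => //; exact/measurable_EFinP.
split => //; rewrite unlock -eqm integral_distribution//; exact/measurable_EFinP.
Qed.

(** Here v is the variance, and v = 0 covers the degenerate case. *)
Lemma gaussian_var_moment (Y : T -> R) :
  measurable_fun setT Y -> gaussian_var P Y ->
  exists m v : R, forall k, rintegrable P (fun w => (Y w - m) ^+ k) /\
    ('E_P[(fun w => (Y w - m) ^+ k)%R] = (v ^+ k./2 * (gmom k)%:R)%:E)%E.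
Proof.
move=> mY [m [s law]]; exists m, (s ^+ 2) => k.
have mf : measurable_fun setT (fun x : R => (x - m) ^+ k).
  by apply: measurable_funX; exact: measurable_funB.
rewrite -gmom_sqr; have [s0|s0] := eqVneq s 0.
  have mE : measurable_fun setT
      (fun x : measurableTypeR R => ((x - m) ^+ k)%:E).
    exact/measurable_EFinP.
  have [] := @integral_law Y (\d_ (m : measurableTypeR R)) _ mY _ mf.
  - by move=> B mB; rewrite law// s0 eqxx.
  - apply/integrableP; split => //.
    rewrite integral_dirac//= ?diracT ?mul1e ?ltry//.
    by apply/measurable_EFinP/measurableT_comp.
  move=> h ->; split => //; rewrite integral_dirac// diracT mul1e subrr s0.
  by case: k {mf mE h} => [|k]; rewrite ?mulr1// !expr0n /= mul0r.
have [i1 e1] := normal_prob_moment m k s0.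
have [] := @integral_law Y (normal_prob m s) _ mY _ mf i1.
  by move=> B mB; rewrite law// (negbTE s0).
by move=> h ->.
Qed.

(** The first two moments identify the parameters of the law, and thereby all
    moments. *)
Lemma centred_gaussian_var_moment (Y : T -> R) : measurable_fun setT Y ->
  gaussian_var P Y -> ('E_P[Y] = 0)%E ->
  has_moments P Y /\
  forall k, ('E_P[(fun w => Y w ^+ k)%R] =
    ((fine ('E_P[(fun w => Y w ^+ 2)%R])%E) ^+ k./2 * (gmom k)%:R)%:E)%E.
Proof.
move=> mY gY EY; have [m [v h]] := gaussian_var_moment mY gY.
have m0 : m = 0.
  have [i1 e1] := h 1%N.
  have : ('E_P[(fun w => (Y w - m) ^+ 1) \+ cst m]%R = m%:E)%E.
    rewrite expectationD; [|exact/Lfun1_integrable|].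
      by rewrite e1 expectation_cst /= mulr0 add0e.
    by apply/Lfun1_integrable; exact: finite_measure_integrable_cst.
  rewrite (_ : _ \+ _ = Y); last by apply/funext => w /=; rewrite expr1 subrK.
  by rewrite EY => -[].
have {}h k : rintegrable P (fun w => Y w ^+ k) /\
    ('E_P[(fun w => Y w ^+ k)%R] = (v ^+ k./2 * (gmom k)%:R)%:E)%E.
  by have := h k; rewrite m0; under eq_fun do rewrite subr0.
split; first by split => // k; have [] := h k.
move=> k; rewrite (h k).2 (h 2%N).2 /=; congr (_ ^+ _ * _)%:E.
by rewrite expr1 mulr1.
Qed.
End Law.

Section GaussianVectorMoments.
Local Open Scope classical_set_scope.
Context disp (T : measurableType disp) (R : realType) (P : probability T R).
Variables (d : nat) (V : 'M[R]_d) (X : {RV P >-> Rvec R d}).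
Hypothesis gX : centred_gaussian_vec P V X.
Let Y w : 'I_d -> R := tnth (X w).

Let mY i : measurable_fun setT (fun w => Y w i).
Proof. exact: ((measurable_fun_tnthP _).1 (measurable_funPT X) i). Qed.

Let lc (t : 'I_d -> R) w := \sum_i t i * Y w i.

Let mlc t : measurable_fun setT (lc t).
Proof. by apply: measurable_sum => i; exact: measurable_funM. Qed.

Let hmY i : has_moments P (fun w => Y w i).
Proof.
have [gv EX _] := gX.
have E : lc (fun j => (j == i)%:R) = (fun w => Y w i).
  apply/funext => w; rewrite /lc (bigD1 i)//= eqxx mul1r.
  by rewrite big1 ?addr0// => j /negbTE->; rewrite mul0r.
have gYi : gaussian_var P (fun w => Y w i) by rewrite -E; exact: gv.
by have [] := centred_gaussian_var_moment (mY i) gYi (EX i).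
Qed.

Lemma mixed_moments_gaussian : mixed_moments P Y.
Proof.
move=> a; apply: has_moments_integrable; apply: has_moments_prod => i.
exact: has_momentsX.
Qed.

Lemma covariance_entry i j : fine ('E_P[(fun w => Y w i * Y w j)%R])%E = V i j.
Proof.
have [_ EX cov] := gX.
have := cov i j; rewrite covariance.unlock.
have -> : ((fun w => tnth (X w) i) \- cst (fine 'E_P[fun w => tnth (X w) i])%E) *
   ((fun w => tnth (X w) j) \- cst (fine 'E_P[fun w => tnth (X w) j])%E) =
   (fun w => Y w i * Y w j).
  by apply/funext => w; rewrite !EX /= fctE /= !subr0.
by move=> ->.
Qed.

Let lc_second t : fine ('E_P[(fun w => lc t w ^+ 2)%R])%E =
  \sum_i \sum_j t i * t j * V i j.
Proof.
have -> : (fun w => lc t w ^+ 2) =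
    (fun w => \sum_(p : 'I_d * 'I_d) (t p.1 * t p.2) * (Y w p.1 * Y w p.2)).
  apply/funext => w; rewrite expr2 /lc mulr_suml.
  under eq_bigr do rewrite mulr_sumr.
  by rewrite pair_big /=; apply: eq_bigr => p _; ring.
rewrite expectation_lin => [|p].
  by rewrite pair_big /=; apply: eq_bigr => p _; rewrite covariance_entry.
by apply: has_moments_integrable; exact: has_momentsM.
Qed.

Let lc_moment t k : fine ('E_P[(fun w => lc t w ^+ k)%R])%E =
  (\sum_i \sum_j t i * t j * V i j) ^+ k./2 * (gmom k)%:R.
Proof.
have [gv EX _] := gX.
have E0 : ('E_P[lc t] = 0)%E.
  have ir i : rintegrable P (fun w => Y w i) by exact: has_moments_integrable.
  have fin : ('E_P[lc t] \is a fin_num)%E.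
    apply: expectation_fin_num; apply/Lfun1_integrable; exact: rintegrable_sum.
  rewrite -(fineK fin) expectation_lin//; congr EFin.
  by rewrite big1// => i _; rewrite EX mulr0.
have [_ ->] := centred_gaussian_var_moment (mlc t) (gv t) E0.
by rewrite lc_second.
Qed.

Lemma covariance_sym : V^T = V.
Proof.
apply/matrixP => i j; rewrite mxE -!covariance_entry.
by congr (fine (expectation _ _)); apply/funext => w; rewrite mulrC.
Qed.

Lemma covariance_psd (t : 'rV[R]_d) : 0 <= (t *m V *m t^T) 0 0.
Proof.
have -> : (t *m V *m t^T) 0 0 = \sum_i \sum_j t 0 i * t 0 j * V i j.
  rewrite mxE exchange_big; apply: eq_bigr => j _ /=.
  by rewrite mxE mulr_suml; apply: eq_bigr => i _; rewrite mxE; ring.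
rewrite -lc_second; apply: fine_ge0; apply: expectation_ge0 => w.
exact: sqr_ge0.
Qed.

Lemma mx_rootP : mx_root V *m (mx_root V)^T = V.
Proof.
have [B BE] := psd_root covariance_sym covariance_psd.
exact: (@xgetPex _ 0 [set A | A *m A^T = V] (ex_intro _ B BE)).
Qed.

(** X and B G, with B B^T = V and G standard normal, have the same moments along
    every linear form, since t.X and t.(B G) are centred Gaussian with the same
    variance; by polarization they have the same mixed moments. *)
Lemma gaussian_moment (a : 'I_d -> nat) :
  moment P Y a = moment (std_normal d) (lincoord (mx_root V)) a.
Proof.
set B := mx_root V.
pose F := monfun (fun a : multinom d =>
  moment P Y a - moment (std_normal d) (lincoord B) a).
have FE p : F p = monfun (moment P Y) p -
    monfun (moment (std_normal d) (lincoord B)) p.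
  by rewrite /F /monfun -sumrB; apply: eq_bigr => b _; rewrite mulrBr.
suff F0 : F =1 fun=> 0.
  pose m := Multinom [tuple a i | i < d]; have := F0 (mpolyX R m).
  rewrite FE !monfunX => /eqP; rewrite subr_eq0 => /eqP.
  have -> : fun_of_multinom m = a.
    by apply/funext => i; rewrite mnm_tnth tnth_mktuple.
  by [].
suff FL c k : F (linform c ^+ k) = 0.
  exact: (@polarization d R (monfun _) FL).
rewrite FE -!expectation_meval; [|exact: mixed_moments_lin|exact: mixed_moments_gaussian].
apply/eqP; rewrite subr_eq0; apply/eqP.
under eq_fun do rewrite rmorphXn /= meval_linform.
rewrite lc_moment.
pose cB j := \sum_i c i * B i j.
have VB i j : V i j = \sum_l B i l * B j l.
  by rewrite -[in LHS]mx_rootP mxE; apply: eq_bigr => l _; rewrite mxE.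
transitivity (gauss (linform cB ^+ k)).
  rewrite gauss_linform_exp; congr (_ ^+ _ * _).
  transitivity (\sum_i \sum_j \sum_l (c i * B i l) * (c j * B j l)).
    apply: eq_bigr => i _; apply: eq_bigr => j _.
    by rewrite VB mulr_sumr; apply: eq_bigr => l _; ring.
  under eq_bigr do rewrite exchange_big.
  rewrite exchange_big; apply: eq_bigr => l _ /=.
  by rewrite /cB big_distrlr.
have -> : gauss (linform cB ^+ k) =
    monfun (moment (std_normal d) (@vcoord R d)) (linform cB ^+ k).
  by rewrite /gauss; congr monfun; apply/funext => b; rewrite moment_std.
rewrite -expectation_meval; last exact: mixed_moments_std.
congr (fine (expectation _ _)); apply/funext => z.
rewrite !rmorphXn /= !meval_linform; congr (_ ^+ _).
rewrite /lincoord; under [RHS]eq_bigr do rewrite mulr_sumr.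
rewrite exchange_big; apply: eq_bigr => j _ /=.
by rewrite /cB mulr_suml; apply: eq_bigr => i _; rewrite mulrA.
Qed.
End GaussianVectorMoments.

(** * The linear forms behind the Hermite polynomials *)

Section HermiteForms.
Local Open Scope complex_scope.
Variables (R : realType) (d : nat) (V : 'M[R]_d).
Let B := mx_root V.
Let A := mx_root (invmx V).

(** xi_form and eta_form are xi_a = (V^-1 x)_a + i z_a and eta_b = x_b + i z'_b in
    the variables (x, z, z'); std_xi and std_eta are what they become after the
    substitution (x, z, z') = (B g, A g', B g''). *)
Definition xi_form (a : 'I_d) : 'I_(d + (d + d)) -> R[i] :=
  cat3 (fun b => (invmx V a b)%:C) (fun j => 'i * (j == a)%:R) (fun=> 0).
Definition eta_form (b : 'I_d) : 'I_(d + (d + d)) -> R[i] :=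
  cat3 (fun j => (j == b)%:R) (fun=> 0) (fun j => 'i * (j == b)%:R).
Definition std_xi (a : 'I_d) : 'I_(d + (d + d)) -> R[i] :=
  cat3 (fun j => ((invmx V *m B) a j)%:C) (fun j => 'i * (A a j)%:C) (fun=> 0).
Definition std_eta (b : 'I_d) : 'I_(d + (d + d)) -> R[i] :=
  cat3 (fun j => (B b j)%:C) (fun=> 0) (fun j => 'i * (B b j)%:C).

Let sum_delta (a : 'I_d) (c : R[i]) (x : 'I_d -> R[i]) :
  \sum_j c * (j == a)%:R * x j = c * x a.
Proof.
rewrite (bigD1 a)//= eqxx mulr1 big1 ?addr0// => j /negbTE->.
by rewrite mulr0 mul0r.
Qed.

Let sum0l (x : 'I_d -> R[i]) : \sum_j 0 * x j = 0.
Proof. by rewrite big1// => j _; rewrite mul0r. Qed.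

Let sum0r (x : 'I_d -> R[i]) : \sum_j x j * 0 = 0.
Proof. by rewrite big1// => j _; rewrite mulr0. Qed.

Lemma meval_xi_form (x y z : 'I_d -> R) a :
  meval (fun i => (cat3 x y z i)%:C) (linform (xi_form a)) =
  Complex (\sum_b invmx V a b * x b) (y a).
Proof.
rewrite meval_cat3 sum0l addr0 sum_delta [RHS]complexE /= rmorph_sum.
by congr (_ + _); apply: eq_bigr => b _; rewrite rmorphM.
Qed.

Lemma meval_eta_form (x y z : 'I_d -> R) b :
  meval (fun i => (cat3 x y z i)%:C) (linform (eta_form b)) =
  Complex (x b) (z b).
Proof.
rewrite meval_cat3 sum0l add0r sum_delta [RHS]complexE /=; congr (_ + _).
by under eq_bigr do rewrite -[_%:R]mul1r; rewrite sum_delta mul1r.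
Qed.

Lemma meval_std_xi (x y z : Rvec R d) a :
  meval (fun i => (cat3 (vcoord x) (vcoord y) (vcoord z) i)%:C)
    (linform (std_xi a)) =
  Complex (\sum_b invmx V a b * lincoord B x b) (lincoord A y a).
Proof.
rewrite meval_cat3 sum0l addr0 [RHS]complexE /=; congr (_ + _).
  rewrite rmorph_sum /lincoord /vcoord.
  under [RHS]eq_bigr do rewrite mulr_sumr rmorph_sum.
  rewrite exchange_big; apply: eq_bigr => j _ /=.
  rewrite mxE rmorph_sum mulr_suml; apply: eq_bigr => b _.
  by rewrite !rmorphM mulrA.
rewrite /lincoord rmorph_sum mulr_sumr; apply: eq_bigr => j _.
by rewrite rmorphM mulrA.
Qed.

Lemma meval_std_eta (x y z : Rvec R d) b :
  meval (fun i => (cat3 (vcoord x) (vcoord y) (vcoord z) i)%:C)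
    (linform (std_eta b)) =
  Complex (lincoord B x b) (lincoord B z b).
Proof.
rewrite meval_cat3 sum0l add0r [RHS]complexE /= /lincoord; congr (_ + _).
  by rewrite rmorph_sum; apply: eq_bigr => j _; rewrite rmorphM.
rewrite rmorph_sum mulr_sumr; apply: eq_bigr => j _.
by rewrite rmorphM mulrA.
Qed.

Hypotheses (uV : V \in unitmx) (BB : B *m B^T = V).

Let AA : A *m A^T = invmx V. Proof. exact: mx_root_invmx. Qed.
Let Vsym : V^T = V. Proof. by rewrite -BB trmx_mul trmxK. Qed.

Let sumM (M N : 'M[R]_d) a c :
  \sum_j (M a j)%:C * (N c j)%:C = ((M *m N^T) a c)%:C.
Proof. by rewrite mxE rmorph_sum; apply: eq_bigr => j _; rewrite mxE rmorphM. Qed.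

Let sumiM (M N : 'M[R]_d) a c :
  \sum_j 'i * (M a j)%:C * ('i * (N c j)%:C) = - ((M *m N^T) a c)%:C.
Proof.
rewrite -sumM -mulN1r mulr_sumr; apply: eq_bigr => j _.
by rewrite mulrACA -expr2 sqr_i.
Qed.

(** V^-1 V V^-1 from x, and i^2 V^-1 from z. *)
Lemma std_xi_xi a c : \sum_i std_xi a i * std_xi c i = 0.
Proof.
rewrite dot_cat3 sum0l addr0 sumM sumiM AA trmx_mul trmx_inv Vsym.
by rewrite mulmxA -(mulmxA _ B) BB mulVmx// mul1mx subrr.
Qed.

(** V from x, and i^2 V from z'. *)
Lemma std_eta_eta b c : \sum_i std_eta b i * std_eta c i = 0.
Proof. by rewrite dot_cat3 sum0l add0r sumM sumiM subrr. Qed.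

(** Only x contributes, V^-1 V, as z and z' are independent. *)
Lemma std_xi_eta a b : \sum_i std_xi a i * std_eta b i = (a == b)%:R.
Proof.
by rewrite dot_cat3 sum0l sum0r !addr0 sumM -mulmxA BB mulVmx// mxE rmorph_nat.
Qed.

End HermiteForms.

(** * Orthogonality *)

Section HermiteProduct.
Local Open Scope complex_scope.
Variables (R : realType) (d : nat) (V : 'M[R]_d) (n m : {ffun 'I_d -> nat}).

Definition hermite_poly : mpoly (d + (d + d)) R[i] :=
  (\prod_a linform (xi_form V a) ^+ n a) *
  \prod_b linform (eta_form R b) ^+ m b.

Definition std_hermite_poly : mpoly (d + (d + d)) R[i] :=
  (\prod_a linform (std_xi V a) ^+ n a) *
  \prod_b linform (std_eta V b) ^+ m b.

Lemma meval_hermite_poly (x y z : 'I_d -> R) :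
  meval (fun i => (cat3 x y z i)%:C) hermite_poly =
  (\prod_a Complex (\sum_b invmx V a b * x b) (y a) ^+ n a) *
  \prod_b Complex (x b) (z b) ^+ m b.
Proof.
rewrite mevalM !meval_linform_pow.
under eq_bigr do rewrite meval_xi_form.
by under [X in _ * X]eq_bigr do rewrite meval_eta_form.
Qed.

Lemma meval_std_hermite_poly (x y z : Rvec R d) :
  meval (fun i => (cat3 (vcoord x) (vcoord y) (vcoord z) i)%:C)
    std_hermite_poly =
  meval (fun i => (cat3 (lincoord (mx_root V) x)
    (lincoord (mx_root (invmx V)) y) (lincoord (mx_root V) z) i)%:C)
    hermite_poly.
Proof.
rewrite meval_hermite_poly mevalM !meval_linform_pow.
under eq_bigr do rewrite meval_std_xi.
by under [X in _ * X]eq_bigr do rewrite meval_std_eta.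
Qed.

Let cintegrable_prod (U : 'M[R]_d) (u : 'I_d -> R) (k : {ffun 'I_d -> nat}) :
  cintegrable (mvnormal U) (fun z => \prod_a Complex (u a) (tnth z a) ^+ k a).
Proof.
have [hU _] := mvnormal_moment U.
pose q : mpoly d R[i] :=
  \prod_a ((u a)%:C *: 1 + 'i *: mpolyX _ (mnm1 a)) ^+ k a.
have -> : (fun z : Rvec R d => \prod_a Complex (u a) (tnth z a) ^+ k a) =
    (fun z => meval (fun i => (vcoord z i)%:C) q).
  apply/funext => z; rewrite rmorph_prod; apply: eq_bigr => j _.
  rewrite rmorphXn /= mevalD !mevalZ meval1 mulr1 mevalXU.
  by rewrite [Complex _ _]complexE.
exact: cintegrable_meval.
Qed.

(** The two expectations defining the factors become one iterated expectation of a
    single polynomial, by linearity of each of them. *)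
Lemma hermite_mul (x : Rvec R d) :
  hermite n (col_of x) V * hermite_tilde m (col_of x) V =
  cexpectation (mvnormal (invmx V)) (fun y => cexpectation (mvnormal V) (fun z =>
    meval (fun i => (cat3 (tnth x) (vcoord y) (vcoord z) i)%:C) hermite_poly)).
Proof.
rewrite /hermite /hermite_tilde.
set f := (fun z => \prod_a _); set g := (fun z => \prod_b _).
have evE y z : meval (fun i => (cat3 (tnth x) (vcoord y) (vcoord z) i)%:C)
    hermite_poly = f y * g z.
  rewrite meval_hermite_poly; congr (_ * _); apply: eq_bigr => j _.
    by rewrite mxE; under [in RHS]eq_bigr do rewrite mxE.
  by rewrite mxE.
under eq_fun => y.
  under eq_fun do rewrite evE.
  rewrite cexpectationZ; last exact: cintegrable_prod.
  rewrite mulrC.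
  over.
rewrite [RHS](@cexpectationZ _ _ _ _ _ f); last exact: cintegrable_prod.
exact: mulrC.
Qed.

End HermiteProduct.

Theorem theorem2p7 (R : realType) (d : nat)
  (disp : measure_display) (T : measurableType disp) (P : probability T R)
  (V : 'M[R]_d) (X : {RV P >-> Rvec R d})
  (V_inv : V \in unitmx) (X_gauss : centred_gaussian_vec P V X)
  (n m : {ffun 'I_d -> nat}) :
  cexpectation P
    (fun w => hermite n (col_of (X w)) V * hermite_tilde m (col_of (X w)) V)
  = if n == m then (\prod_j (n j)`!)%:R else 0.
Proof.
have BB := mx_rootP X_gauss.
have [mm2 m2E] := mvnormal_moment (invmx V).
have [mm3 m3E] := mvnormal_moment V.
have mm1 := mixed_moments_gaussian X_gauss.
rewrite (funext (fun w => hermite_mul V n m (X w))) cexpectation3//.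
(* replace the three vectors by linear images of standard normal vectors *)
have -> : moment P (fun w => tnth (X w)) =
    moment (std_normal d) (lincoord (mx_root V)).
  by apply/funext => a; exact: (gaussian_moment X_gauss).
rewrite (funext m2E) (funext m3E) -cexpectation3; try exact: mixed_moments_lin.
under eq_fun do under eq_fun do
  under eq_fun do rewrite -meval_std_hermite_poly.
rewrite cexpectation3; try exact: mixed_moments_std.
rewrite moment3_std; apply: gauss_biorthogonal.
- exact: std_xi_xi.
- exact: std_eta_eta.
- exact: std_xi_eta.
Qed.
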